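(* For every composition $\lambda$ of $n$, the poset $C_\lambda\subseteq S_n$, with the restriction of the Bruhat-Chevalley ordering of $S_n$, is EL-shellable.
   Context: $S_n$ is the symmetric group on $[n]=\{1,\dots,n\}$. The standard cyclic form of $\pi\in S_n$ is its expression as a product of disjoint cycles $(a_{1,1},\dots,a_{k_1,1})\cdots(a_{1,m},\dots,a_{k_m,m})$, where cycles of length one are NOT omitted, each cycle begins with its smallest entry, and cycles are ordered by increasing first entries. The composition type of $\pi$ is $(k_1,\dots,k_m)\vDash n$. The map $\Omega:S_n\to S_n$ sends $\pi$ to the permutation whose one-line notation is the word obtained by deleting the parentheses from the standard cyclic form of $\pi$. For $\lambda\vDash n$, $A_\lambda$ is the set of permutations of composition type $\lambda$ and $C_\lambda:=\Omega(A_\lambda)$. $inv(x)=|\{(i,j):i<j,\ x(i)>x(j)\}|$; the Bruhat-Chevalley order on $S_n$ is the transitive closure of $x<y$ where $y$ is obtained from $x$ by swapping two entries $a_i<a_j$ at positions $i<j$ with $inv(y)=inv(x)+1$. A finite graded poset $P$ with minimum and maximum is EL-shellable if there is a map $f$ from the set of covering relations of $P$ to a totally ordered set such that in every interval $[x,y]$ of length $k>0$ there is a unique saturated chain $x=x_0<x_1<\cdots<x_k=y$ whose label sequence $(f(x_0,x_1),\dots,f(x_{k-1},x_k))$ is weakly increasing, and this sequence is lexicographically smallest among the label sequences of all saturated chains from $x$ to $y$. *)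

(* Defs.v *)
From HB Require Import structures.
From mathcomp Require Import all_boot all_order all_fingroup.

Set Implicit Arguments.
Unset Strict Implicit.
Unset Printing Implicit Defensive.

Import Order.TTheory.

(* [n] = {1, ..., n} is encoded as 'I_n = {0, ..., n - 1}. *)

Definition is_composition (n : nat) (lambda : seq nat) : Prop :=
  0 \notin lambda /\ sumn lambda = n.

Section StandardCyclicForm.

Variable n : nat.
Implicit Types (p x : 'S_n) (i j : 'I_n).

Definition cycle_min p i : bool := [forall j in porbit p i, i <= j].

(* The cycle (a, p a, p (p a), ...) is read from its smallest entry; enum 'I_n
   is increasing, so the cycles come in increasing order of first entries.
   Fixed points give cycles of length one. *)
Definition std_cyclic_form p : seq (seq 'I_n) :=
  [seq traject p i #|porbit p i| | i <- enum 'I_n & cycle_min p i].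

Definition composition_type p : seq nat := map size (std_cyclic_form p).

Definition cyclic_word p : seq 'I_n := flatten (std_cyclic_form p).

Definition one_line x : seq 'I_n := [seq x i | i <- enum 'I_n].

Lemma mem_cyclic_word p j : j \in cyclic_word p.
Proof.
pose i := [arg min_(k < j in porbit p j) (k : nat)].
have [ij mini] : i \in porbit p j /\ forall k, k \in porbit p j -> i <= k.
  by rewrite /i; case: arg_minnP => [|k kj mk]; [exact: porbit_id | split].
have eij : porbit p i = porbit p j by apply/eqP; rewrite eq_porbit_mem.
apply/flattenP; exists (traject p i #|porbit p i|); last first.
  by rewrite -porbit_traject eij porbit_id.
apply: map_f; rewrite mem_filter mem_enum andbT.
by apply/forall_inP => k; rewrite eij; apply: mini.
Qed.

Lemma cyclic_word_uniq p : uniq (cyclic_word p).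
Proof.
rewrite /cyclic_word /std_cyclic_form.
have : all (cycle_min p) [seq i <- enum 'I_n | cycle_min p i] by apply: filter_all.
have : uniq [seq i <- enum 'I_n | cycle_min p i] by rewrite filter_uniq ?enum_uniq.
elim: [seq i <- _ | _] => //= i r IHr /andP[ir ur] /andP[mi mr].
rewrite cat_uniq uniq_traject_porbit IHr // andbT.
apply/hasPn => j /flattenP[_ /mapP[k kr ->]].
rewrite -!porbit_traject => jk; apply/negP => ji.
have eik : porbit p i = porbit p k.
  move: jk ji; rewrite -!eq_porbit_mem => /eqP <- /eqP <- //.
suff eq_ik : i = k by rewrite eq_ik kr in ir.
have mk := allP mr k kr.
apply/val_inj/eqP; rewrite eqn_leq.
rewrite (forall_inP mi) ?eik ?porbit_id //.
by rewrite (forall_inP mk) // -eik porbit_id.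
Qed.

Lemma size_cyclic_word p : size (cyclic_word p) = n.
Proof.
rewrite -[RHS](size_enum_ord n); apply/perm_size/uniq_perm.
- exact: cyclic_word_uniq.
- exact: enum_uniq.
- by move=> j; rewrite mem_cyclic_word mem_enum.
Qed.

Lemma cyclic_word_inj p : injective (fun i => nth i (cyclic_word p) i).
Proof.
move=> i j; rewrite (set_nth_default i j) ?size_cyclic_word // => /eqP.
by rewrite nth_uniq ?size_cyclic_word ?cyclic_word_uniq // => /eqP/val_inj.
Qed.

Definition Omega p : 'S_n := perm (@cyclic_word_inj p).

Lemma one_line_Omega p : one_line (Omega p) = cyclic_word p.
Proof.
case def_w: (cyclic_word p) (size_cyclic_word p) => [|i0 w] /= sz.
  by apply: size0nil; rewrite size_map size_enum_ord; exact: esym sz.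
apply: (@eq_from_nth _ i0) => [|k].
  by rewrite size_map size_enum_ord; exact: esym sz.
rewrite size_map size_enum_ord => ltkn.
rewrite (nth_map i0) ?size_enum_ord // permE def_w nth_enum_ord //.
by apply: set_nth_default; rewrite /= sz.
Qed.

Definition Aset (lambda : seq nat) : {set 'S_n} :=
  [set p | composition_type p == lambda].

Definition Cset (lambda : seq nat) : {set 'S_n} := Omega @: Aset lambda.

End StandardCyclicForm.

Section Bruhat.

Variable n : nat.
Implicit Types x y : 'S_n.

Definition inv x : nat :=
  #|[set ij : 'I_n * 'I_n | (ij.1 < ij.2) && (x ij.2 < x ij.1)]|.

(* (tperm i j * x) k = x (tperm i j k): the entries at positions i and j of the
   one-line notation of x are swapped. *)
Definition bruhat_step : rel 'S_n := fun x y =>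
  [exists i : 'I_n, exists j : 'I_n,
    [&& i < j, x i < x j, y == (tperm i j * x)%g & inv y == (inv x).+1]].

Definition bruhat_le : rel 'S_n := connect bruhat_step.

Lemma bruhat_le_inv x y : bruhat_le x y -> x = y \/ inv x < inv y.
Proof.
case/connectP => s; elim: s x => [|z s IHs] x /=; first by move=> _ ->; left.
case/andP => /existsP[i /existsP[j /and4P[_ _ _ /eqP ez]]] zs ey.
by right; case: (IHs z zs ey) => [<-|]; rewrite ez //; apply: ltn_trans.
Qed.

Lemma bruhat_le_refl : reflexive bruhat_le.
Proof. exact: connect0. Qed.

Lemma bruhat_le_anti : antisymmetric bruhat_le.
Proof.
move=> x y /andP[/bruhat_le_inv[//|lt_xy] /bruhat_le_inv[//|lt_yx]].
by have := ltn_trans lt_xy lt_yx; rewrite ltnn.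
Qed.

Lemma bruhat_le_trans : transitive bruhat_le.
Proof. exact: connect_trans. Qed.

End Bruhat.

Fact bruhat_display : Order.disp_t. Proof. exact: Order.Disp tt tt. Qed.

Definition bruhat (n : nat) : Type := 'S_n.

HB.instance Definition _ n := Finite.on (bruhat n).
HB.instance Definition _ n := Order.Le_isPOrder.Build bruhat_display (bruhat n)
  (@bruhat_le_refl n) (@bruhat_le_anti n) (@bruhat_le_trans n).

Definition Cposet (n : nat) (lambda : seq nat) : Type :=
  {x : bruhat n | x \in Cset n lambda}.

HB.instance Definition _ n lambda := SubFinite.on (Cposet n lambda).
HB.instance Definition _ n lambda :=
  [SubChoice_isSubPOrder of Cposet n lambda by <: with bruhat_display].

Section ELShellability.

Variables (d : Order.disp_t) (P : finPOrderType d).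

Definition covers : rel P := fun x y =>
  (x < y)%O && ~~ [exists z, (x < z)%O && (z < y)%O].

Definition chain (A : {set P}) : bool :=
  [forall x in A, forall y in A, (x >=< y)%O].

Definition graded : Prop :=
  forall A B : {set P}, maxset chain A -> maxset chain B -> #|A| = #|B|.

Definition has_minimum : Prop := exists x0 : P, forall x, (x0 <= x)%O.

Definition has_maximum : Prop := exists x1 : P, forall x, (x <= x1)%O.

(* s lists the elements other than x of the chain x = x_0 < ... < x_k = y. *)
Definition saturated_chain (x y : P) (s : seq P) : bool :=
  path covers x s && (last x s == y).

Section Labeling.

(* Only the values of f on the covering relations are ever used. *)
Variables (dL : Order.disp_t) (L : orderType dL) (f : P -> P -> L).

Definition labels (x : P) (s : seq P) : seqlexi L := pairmap f x s.

Definition increasing_chain (x y : P) (s : seq P) : bool :=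
  saturated_chain x y s && sorted <=%O (labels x s : seq L).

Definition EL_labeling : Prop :=
  forall x y : P, (x < y)%O ->
  exists2 s : seq P,
    increasing_chain x y s /\ (forall t, increasing_chain x y t -> t = s) &
    forall t, saturated_chain x y t -> (labels x s <= labels x t)%O.

End Labeling.

Definition EL_shellable : Prop :=
  [/\ has_minimum, has_maximum, graded &
      exists (dL : Order.disp_t) (L : orderType dL) (f : P -> P -> L),
        EL_labeling f].

End ELShellability.

(* Main.v *)
From mathcomp Require Import all_boot all_order all_fingroup zify.
Require Import Defs.

(** A permutation x lies in [Cset n lambda] iff, in its one-line notation, the
    entry at every block start is smaller than all later entries.

    Label the covering relation that swaps positions i < j by (i, j), ordered
    lexicographically.  For x < y in the Bruhat order let i be the first position
    where x and y differ, and j > i the first one with x i < x j <= y i.  The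
    dominance description of the Bruhat order shows that swapping i and j gives a
    cover x' of x with x' <= y.  If x and y are in [Cset n lambda], then i is not
    a block start, since at a block start both have the least remaining entry;
    and swapping at such an i stays inside the set.  Hence covers in the subposet
    are Bruhat covers, (i, j) is the least possible first label of a chain from x
    to y, the greedy chain is increasing, and an increasing chain that does not
    start with (i, j) can never raise the entry in position i up to x j <= y i. *)

Set Implicit Arguments.
Unset Strict Implicit.
Unset Printing Implicit Defensive.

Import Order.TTheory.

(** * Bruhat order and dominance *)

Definition swap (n : nat) (x : 'S_n) (i j : 'I_n) : 'S_n := (tperm i j * x)%g.

Lemma swapL (n : nat) (x : 'S_n) (i j : 'I_n) : swap x i j i = x j.
Proof. by rewrite permM tpermL. Qed.

Lemma swapR (n : nat) (x : 'S_n) (i j : 'I_n) : swap x i j j = x i.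
Proof. by rewrite permM tpermR. Qed.

Lemma swapD (n : nat) (x : 'S_n) (i j k : 'I_n) :
  k != i -> k != j -> swap x i j k = x k.
Proof. by move=> ki kj; rewrite permM tpermD // eq_sym. Qed.

Lemma perm_val_inj (n : nat) (x : 'S_n) (i j : 'I_n) :
  x i = x j :> nat -> i = j.
Proof. by move/val_inj/perm_inj. Qed.

(** * Inversions and Bruhat steps under a swap of two entries *)

Lemma inv_sum (n : nat) (x : 'S_n) :
  inv x = \sum_(a : 'I_n) \sum_(b : 'I_n) ((a < b) && (x b < x a)).
Proof.
rewrite /inv -sum1_card pair_big big_mkcond /=.
by apply: eq_bigr => -[a b] _; rewrite inE /=; case: ifP.
Qed.

Lemma sum_split1 (T : finType) (G : T -> nat) (i : T) :
  \sum_a G a = G i + \sum_(a | a != i) G a.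
Proof. by rewrite (bigD1 i). Qed.

Lemma sum_split2 (T : finType) (G : T -> nat) (i j : T) : j != i ->
  \sum_a G a = G i + G j + \sum_(c | (c != i) && (c != j)) G c.
Proof. by move=> ji; rewrite (sum_split1 _ i) (bigD1 j) //= addnA. Qed.

Lemma sum2_split (T : finType) (F : T -> T -> nat) (i j : T) : j != i ->
  \sum_a \sum_b F a b =
  F i i + F j j + F i j + F j i
  + \sum_(c | (c != i) && (c != j)) (F i c + F c i + F j c + F c j)
  + \sum_(a | (a != i) && (a != j)) \sum_(b | (b != i) && (b != j)) F a b.
Proof.
move=> ji.
rewrite (sum_split2 _ ji) !(sum_split2 (F _) ji).
rewrite (eq_bigr _ (fun a _ => sum_split2 (F a) ji)).
by rewrite !big_split /=; lia.
Qed.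

(** Only pairs meeting [{i, j}] change status. The pair [(i, j)] gains one inversion, and each [c]
    between them in both position and value gains two, one with [i] and one with [j]; for any other
    [c] the changes cancel. *)
Lemma inv_swap (n : nat) (x : 'S_n) (i j : 'I_n) : i < j -> x i < x j ->
  inv (swap x i j) =
  (inv x).+1 + (\sum_(c | (c != i) && (c != j))
                  [&& i < c, c < j, x i < x c & x c < x j]).*2.
Proof.
move=> ij xij; have ji : j != i by rewrite -val_eqE /= gtn_eqF.
rewrite !inv_sum !(sum2_split _ ji) !swapL !swapR !ltnn.
set S1 := (X in _ + X + _ = _); set S2 := (X in _ + X = _).
set S3 := (X in _ = (_ + X + _).+1 + _); set S4 := (X in _ = (_ + X).+1 + _).
set S := (X in X.*2).
have -> : S2 = S4.
  by apply: eq_bigr => a /andP[? ?]; apply: eq_bigr => b /andP[? ?]; rewrite !swapD.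
have -> : S1 = S3 + S.*2.
  rewrite -muln2 big_distrl -big_split /=; apply: eq_bigr => c /andP[ci cj].
  rewrite swapD //.
  have : c <> i :> nat by move/val_inj/eqP; apply/negP.
  have : c <> j :> nat by move/val_inj/eqP; apply/negP.
  have : x c <> x i :> nat by move/perm_val_inj/eqP; apply/negP.
  have : x c <> x j :> nat by move/perm_val_inj/eqP; apply/negP.
  by case: (ltngtP c i) => // ?; case: (ltngtP c j) => // ?;
    case: (ltngtP (x c) (x i)) => // ?; case: (ltngtP (x c) (x j)) => // ? *; lia.
by rewrite ij xij (ltnNge j) (ltnW ij) ltnNge (ltnW xij) /=; lia.
Qed.

Lemma inv_swap_step (n : nat) (x : 'S_n) (i j : 'I_n) : i < j -> x i < x j ->
  inv (swap x i j) = (inv x).+1 <->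
  forall k : 'I_n, i < k -> k < j -> ~~ (x i < x k < x j).
Proof.
move=> ij xij; rewrite inv_swap //; split => [e k ik kj | gap].
  have /eqP : \sum_(c | (c != i) && (c != j))
      [&& i < c, c < j, x i < x c & x c < x j] = 0 by lia.
  rewrite sum_nat_eq0 => /forallP/(_ k); rewrite -!val_eqE /= gtn_eqF // ltn_eqF //=.
  by rewrite ik kj eqb0.
rewrite big1 ?addn0 // => c _; apply/eqP; rewrite eqb0; apply/negP.
by case/and4P => ic cj xic xcj; move: (gap c ic cj); rewrite xic xcj.
Qed.

Lemma bruhat_stepP (n : nat) (x y : 'S_n) :
  bruhat_step x y <->
  exists i j : 'I_n, [/\ i < j, x i < x j, y = swap x i j &
    forall k : 'I_n, i < k -> k < j -> ~~ (x i < x k < x j)].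
Proof.
split.
  case/existsP => i /existsP[j /and4P[ij xij /eqP-> /eqP e]].
  by exists i, j; split => //; apply/inv_swap_step.
case=> i [j [ij xij -> gap]]; apply/existsP; exists i; apply/existsP; exists j.
by rewrite ij xij eqxx; apply/eqP/inv_swap_step.
Qed.

Lemma bruhat_step_inv (n : nat) (x y : 'S_n) :
  bruhat_step x y -> inv y = (inv x).+1.
Proof. by case/existsP => i /existsP[j /and4P[_ _ _ /eqP]]. Qed.

(** The rank matrix of a permutation; its entrywise comparison, [dominated], turns out to be the
    Bruhat order. *)
Definition rk (n : nat) (x : 'S_n) (p q : nat) : nat :=
  \sum_(a : 'I_n) ((a < p) && (q <= x a)).

Definition dominated (n : nat) (x y : 'S_n) : Prop :=
  forall p q, rk x p q <= rk y p q.

Lemma rk_swap (n : nat) (x : 'S_n) (i j : 'I_n) (p q : nat) :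
  i < j -> x i < x j ->
  rk (swap x i j) p q = rk x p q + [&& i < p, p <= j, x i < q & q <= x j].
Proof.
move=> ij xij; have ji : j != i by rewrite -val_eqE /= gtn_eqF.
rewrite /rk !(sum_split2 _ ji) swapL swapR.
set S1 := (X in _ + X = _); set S2 := (X in _ = _ + X + _).
have -> : S1 = S2 by apply: eq_bigr => a /andP[? ?]; rewrite swapD.
by move: ij xij; lia.
Qed.

Lemma bruhat_le_dominated (n : nat) (x y : 'S_n) : bruhat_le x y -> dominated x y.
Proof.
case/connectP => s; elim: s x => [|z s IHs] x /=; first by move=> _ -> p q.
case/andP => /bruhat_stepP[i [j [ij xij -> _]]] zs ey p q.
by apply: leq_trans (IHs _ zs ey p q); rewrite rk_swap // leq_addr.
Qed.

(** Compare the ranks at [p = i.+1] and [q = x i]: earlier positions count equally, and position [i]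
    counts for [x], so it must count for [y]. *)
Lemma dominated_first_diff (n : nat) (x y : 'S_n) (i : 'I_n) :
  dominated x y -> (forall a : 'I_n, a < i -> x a = y a) -> x i <= y i.
Proof.
move=> dxy agree; have := dxy i.+1 (x i); rewrite /rk !(sum_split1 _ i).
rewrite ltnSn leqnn /= (eq_bigr (fun a : 'I_n => (a < i.+1) && (x i <= y a) : nat)).
  by rewrite leq_add2r lt0b.
move=> a; rewrite -val_eqE /= => ai; case: (ltnP a i.+1) => //= le_ai.
by rewrite (agree a) // ltn_neqAle ai.
Qed.

(* The first step of the lexicographically smallest chain from x to y. *)
Definition greedy (n : nat) (x y : 'S_n) (i j : 'I_n) : Prop :=
  [/\ forall a : 'I_n, a < i -> x a = y a, i < j, x i < x j <= y i &
      forall k : 'I_n, i < k -> k < j -> ~~ (x i < x k <= y i)].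

Lemma greedy_gap (n : nat) (x y : 'S_n) (i j : 'I_n) : greedy x y i j ->
  forall k : 'I_n, i < k -> k < j -> ~~ (x i < x k < x j).
Proof.
case=> _ ij /andP[_ xjy] gap k ik kj; move: (gap k ik kj) xjy; lia.
Qed.

Lemma greedy_step (n : nat) (x y : 'S_n) (i j : 'I_n) :
  greedy x y i j -> bruhat_step x (swap x i j).
Proof.
move=> g; apply/bruhat_stepP; exists i, j; split => //; last exact: greedy_gap g.
- by case: g.
- by case: g => _ _ /andP[].
Qed.

Lemma greedy_dominated (n : nat) (x y : 'S_n) (i j : 'I_n) :
  greedy x y i j -> dominated x y -> dominated (swap x i j) y.
Proof.
case=> agree ij /andP[xij xjy] gap dxy p q; rewrite rk_swap //.
case: and4P => [[ip pj xiq qxj]|_]; last by rewrite addn0.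
(* Among the first [p] positions, [y] has more entries in [[q, y i]] than [x]: the two agree before
   [i], the entry [y i] itself counts, and by the choice of [j] no entry of [x] from position [i] to
   [p - 1] lies in that range. Dominance at [(y i).+1] handles the entries above it. *)
suff : rk x p q + 1 + rk y p (y i).+1 <= rk y p q + rk x p (y i).+1.
  by have := dxy p (y i).+1; lia.
rewrite /rk !(sum_split1 _ i).
rewrite /=.
set S1 := (X in _ + X + 1 + _ <= _); set S2 := (X in _ + (_ + X) <= _).
set S3 := (X in _ <= _ + X + _); set S4 := (X in _ <= _ + (_ + X)).
suff : S1 + S2 <= S3 + S4 by move: xjy qxj; lia.
rewrite -!big_split /=; apply: leq_sum => a ai.
have [lt_ai|le_ia] := ltnP a i; first by rewrite agree.
have ia : i < a by rewrite ltn_neqAle eq_sym ai.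
have [ap|pa] //= := ltnP a p.
by have := gap a ia (leq_trans ap pj); move: xjy qxj xiq; lia.
Qed.

Lemma first_diff (n : nat) (x y : 'S_n) : x != y ->
  exists2 i : 'I_n, x i != y i & forall a : 'I_n, a < i -> x a = y a.
Proof.
move=> xy; have [i0 xyi0] : exists i, x i != y i.
  apply/existsP; apply: contraR xy => /existsPn eq_xy.
  by apply/eqP/permP => a; apply/eqP; have := eq_xy a; rewrite negbK.
case: (arg_minnP (P := fun i => x i != y i) (@nat_of_ord n) xyi0) => i xyi mini.
by exists i => // a; apply: contraTeq => /mini; rewrite -leqNgt.
Qed.

Lemma first_diff_later (n : nat) (x y : 'S_n) (i : 'I_n) : x i != y i ->
  (forall a : 'I_n, a < i -> x a = y a) -> exists2 j : 'I_n, i < j & x j = y i.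
Proof.
move=> xyi agree; pose j := (x^-1)%g (y i).
have xj : x j = y i by rewrite permKV.
exists j => //; rewrite ltnNge leq_eqVlt; apply/norP; split; apply/negP.
  by move/eqP/val_inj => ej; rewrite -xj ej eqxx in xyi.
by move=> /[dup] ji /agree; rewrite xj => /perm_inj ei; rewrite ei ltnn in ji.
Qed.

Lemma exists_greedy (n : nat) (x y : 'S_n) :
  dominated x y -> x != y -> exists i j, greedy x y i j.
Proof.
move=> dxy /first_diff[i xyi agree].
have xy_lt : x i < y i by rewrite ltn_neqAle xyi dominated_first_diff.
have [j0 ij0 xj0] := first_diff_later xyi agree.
have Pj0 : [&& i < j0, x i < x j0 & x j0 <= y i] by rewrite ij0 xj0 xy_lt leqnn.
case: (arg_minnP (P := fun j : 'I_n => [&& i < j, x i < x j & x j <= y i])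
  (@nat_of_ord n) Pj0) => j /and3P[ij xij xjy] minj.
exists i, j; split; rewrite ?xij // => k ik kj; apply/negP => xk.
by have := minj k; rewrite ik xk leqNgt kj => /(_ isT).
Qed.

(** While [x] differs from [y], a greedy step keeps it dominated by [y] and raises [inv], which is
    bounded by the number of pairs of positions. *)
Lemma dominated_bruhat_le (n : nat) (x y : 'S_n) : dominated x y -> bruhat_le x y.
Proof.
have [m] := ubnP (#|{: 'I_n * 'I_n}| - inv x); elim: m x => // m IHm x lt_m dxy.
have [->|xy] := eqVneq x y; first exact: bruhat_le_refl.
have [i [j g]] := exists_greedy dxy xy; have st := greedy_step g.
apply: (bruhat_le_trans (connect1 st)); apply: IHm (greedy_dominated g dxy).
have : inv (swap x i j) <= #|{: 'I_n * 'I_n}| by exact: max_card.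
by rewrite (bruhat_step_inv st); move: lt_m; lia.
Qed.

Lemma greedy_le (n : nat) (x y : 'S_n) (i j : 'I_n) :
  greedy x y i j -> bruhat_le x y -> bruhat_le (swap x i j) y.
Proof.
by move=> g /bruhat_le_dominated dxy; apply/dominated_bruhat_le/greedy_dominated.
Qed.

(** At most [min(p, q)] of the first [p] entries are below [q], and the identity attains this bound,
    so its ranks are the least possible. *)
Lemma bruhat_le1x (n : nat) (x : 'S_n) : bruhat_le 1%g x.
Proof.
apply: dominated_bruhat_le => p q.
have rkC (z : 'S_n) : rk z p q + #|[set a : 'I_n | (a < p) && (z a < q)]| =
    #|[set a : 'I_n | a < p]|.
  rewrite /rk -!sum1_card !(big_mkcond (fun a => a \in _)) -big_split /=.
  by apply: eq_bigr => a _; rewrite !inE (ltnNge (z a)); case: (a < p); case: (q <= z a).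
suff : #|[set a : 'I_n | (a < p) && (x a < q)]| <=
       #|[set a : 'I_n | (a < p) && ((1%g : 'S_n) a < q)]|.
  by have := rkC x; have := rkC 1%g; lia.
have [pq|/ltnW qp] := leqP p q.
  apply/subset_leq_card/subsetP => a; rewrite !inE perm1 => /andP[ap _].
  by rewrite ap (leq_trans ap).
rewrite -(card_imset _ (@perm_inj _ x)); apply/subset_leq_card/subsetP => b.
case/imsetP => a; rewrite !inE => /andP[_ xaq] ->.
by rewrite perm1 xaq (leq_trans xaq).
Qed.

(** * Finite posets *)

Lemma covers_lt d (P : finPOrderType d) (x y : P) : covers x y -> (x < y)%O.
Proof. by case/andP. Qed.

Lemma covers_nobetween d (P : finPOrderType d) (x y z : P) :
  covers x y -> (x < z)%O -> (z < y)%O -> False.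
Proof. by case/andP => _ /existsPn/(_ z); rewrite negb_and => /orP[] /negP. Qed.

Lemma coversI d (P : finPOrderType d) (x y : P) : (x < y)%O ->
  (forall z, (x < z)%O -> (z < y)%O -> False) -> covers x y.
Proof.
move=> xy nob; rewrite /covers xy; apply/existsPn => z.
by apply/negP => /andP[]; apply: nob.
Qed.

Lemma path_covers_le d (P : finPOrderType d) (x : P) (s : seq P) :
  path (@covers d P) x s -> (x <= last x s)%O.
Proof.
elim: s x => //= y s IHs x /andP[/covers_lt/ltW xy /IHs]; exact: le_trans.
Qed.

Lemma saturated_chainxx d (P : finPOrderType d) (x : P) (s : seq P) :
  saturated_chain x x s -> s = [::].
Proof.
case: s => //= y s; rewrite /saturated_chain /= => /andP[/andP[/covers_lt xy]].
by move=> /path_covers_le + /eqP e; rewrite e (lt_geF xy).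
Qed.

(** The chain to [y] is built by prepending [z] to the chain from [z], by induction on the number of
    elements above [x]. The four conditions supply, in order, the first cover, lexicographic
    minimality, monotonicity at the junction, and uniqueness. *)
Lemma EL_labeling_of_first_step d (P : finPOrderType d)
    dL (L : orderType dL) (f : P -> P -> L) :
  (forall x y : P, (x < y)%O -> exists z : P,
    [/\ covers x z /\ (z <= y)%O,
        forall w, covers x w -> (w <= y)%O ->
          (f x z <= f x w)%O /\ ((f x w <= f x z)%O -> w = z),
        forall w, covers z w -> (w <= y)%O -> (f x z <= f z w)%O &
        forall w s, increasing_chain f x y (w :: s) -> w = z]) ->
  EL_labeling f.
Proof.
move=> step x y; have [m] := ubnP #|[set z | (x < z)%O]|.
elim: m x => // m IHm x lt_m xy.
have [z [[xz zy] zmin zincr zuniq]] := step x y xy.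
have [s [s_incr s_uniq] s_min] : exists2 s : seq P,
    increasing_chain f z y s /\ (forall t, increasing_chain f z y t -> t = s) &
    forall t, saturated_chain z y t -> (labels f z s <= labels f z t)%O.
  (* The induction hypothesis needs [z < y]; for [z = y] the remaining chain is empty. *)
  have [<-|ne_zy] := eqVneq z y.
    exists [::] => [|t /saturated_chainxx-> //]; split; last first.
      by move=> t /andP[/saturated_chainxx].
    by rewrite /increasing_chain /saturated_chain /= eqxx.
  apply: IHm; last by rewrite lt_neqAle ne_zy.
  rewrite -ltnS; apply: leq_trans lt_m; rewrite ltnS; apply: proper_card; apply/properP; split.
    by apply/subsetP => w; rewrite !inE; apply: lt_trans (covers_lt xz).
  by exists z; rewrite !inE ?ltxx ?(covers_lt xz).
exists (z :: s).
  split.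
    move: s_incr; rewrite /increasing_chain /saturated_chain /= xz.
    case/andP => /andP[zs /eqP sy]; rewrite zs sy eqxx /=.
    case: s zs sy {s_uniq s_min} => //= w s /andP[zw ws] sy ->; rewrite andbT.
    by apply: zincr => //; rewrite -sy; apply: path_covers_le.
  case=> [|w t]; first by move=> /andP[/andP[_ /eqP e]]; rewrite -e /= ltxx in xy.
  move=> /[dup] /zuniq -> t_incr; congr cons; apply: s_uniq; move: t_incr.
  rewrite /increasing_chain /saturated_chain /= => /andP[/andP[/andP[_ ->] ->]] /=.
  exact: path_sorted.
case=> [|w t]; first by move=> /andP[_ /eqP e]; rewrite -e /= ltxx in xy.
rewrite /saturated_chain /= => /andP[/andP[xw wt] /eqP ty].
have wy : (w <= y)%O by rewrite -ty; apply: path_covers_le.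
have [zw wz] := zmin w xw wy.
rewrite /labels /= lexi_cons zw /=; apply/implyP => /wz ewz.
by rewrite ewz in wt ty *; apply: s_min; rewrite /saturated_chain wt ty /=.
Qed.

(** A maximal chain contains both extremes and meets each rank between theirs exactly once, so its
    size is determined. *)
Lemma graded_of_rank d (P : finPOrderType d) (rho : P -> nat) (x0 x1 : P) :
  (forall x, x0 <= x)%O -> (forall x, x <= x1)%O ->
  (forall x y, (x < y)%O -> rho x < rho y) ->
  (forall x y, (x < y)%O ->
    exists z, [/\ (x < z)%O, (z <= y)%O & rho z = (rho x).+1]) ->
  graded P.
Proof.
move=> min0 max1 rho_lt rho_step.
have rho_le x y : (x <= y)%O -> rho x <= rho y.
  by rewrite le_eqVlt => /predU1P[-> //|/rho_lt/ltnW].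
suff card_max A : maxset (@chain d P) A -> #|A| = (rho x1).+1 - rho x0.
  by move=> A B /card_max-> /card_max->.
case/maxsetP => /forall_inP chA maxA.
have cmp x y : x \in A -> y \in A -> (x >=< y)%O.
  by move=> xA; move/forall_inP: (chA x xA); apply.
have mem_max x : (forall y, y \in A -> (x >=< y)%O) -> x \in A.
  move=> cx; rewrite -(maxA (x |: A)) ?setU11 ?subsetUr //.
  apply/forall_inP => a /setU1P[->|aA]; apply/forall_inP => b /setU1P[->|bA].
  - exact: comparablexx.
  - exact: cx.
  - by rewrite comparable_sym; apply: cx.
  - exact: cmp.
have A0 : x0 \in A by apply: mem_max => y _; rewrite /Order.comparable min0.
have A1 : x1 \in A by apply: mem_max => y _; rewrite /Order.comparable max1 orbT.
have rho_inj : {in A &, injective rho}.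
  move=> x y xA yA e; have := cmp x y xA yA; rewrite comparable_sym.
  by case/comparable_ltgtP => // /rho_lt; rewrite e ltnn.
have rho_mono x y : x \in A -> y \in A -> rho x <= rho y -> (x <= y)%O.
  move=> xA yA le_xy; case: (comparable_leP (cmp x y xA yA)) => // /rho_lt.
  by rewrite ltnNge le_xy.
have rho_onto k : rho x0 <= k -> k <= rho x1 -> exists2 x, x \in A & rho x = k.
  elim: k => [|k IHk] le0k lek1; first by exists x0 => //; apply/eqP; rewrite -leqn0.
  have [e|ne] := eqVneq (rho x0) k.+1; first by exists x0.
  have [|x xA rx] := IHk _ (ltnW lek1); first by rewrite -ltnS ltn_neqAle ne.
  (* With [y] the element of [A] of least rank above [k], an element [z] of rank [k.+1] with
     [x < z <= y] is comparable to all of [A], hence in [A] by maximality. *)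
  have P1 : (x1 \in A) && (k < rho x1) by rewrite A1.
  case: (arg_minnP (P := fun y => (y \in A) && (k < rho y)) rho P1).
  move=> y /andP[yA ky] miny.
  have xy : (x < y)%O.
    rewrite lt_leAnge rho_mono ?rx // ?(ltnW ky) //.
    by apply/negP => /rho_le; rewrite rx leqNgt ky.
  have [z [xz zy rz]] := rho_step x y xy; rewrite rx in rz; exists z => //.
  apply: mem_max => a aA; rewrite /Order.comparable.
  have [ka|ak] := ltnP k (rho a).
    by rewrite (le_trans zy) // rho_mono // miny // aA.
  by rewrite [X in _ || X](le_trans _ (ltW xz)) ?orbT // rho_mono // rx.
have perm_rho : perm_eq (map rho (enum A)) (iota (rho x0) ((rho x1).+1 - rho x0)).
  apply: uniq_perm; first rewrite map_inj_in_uniq ?enum_uniq //.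
  - by move=> x y; rewrite !mem_enum; apply: rho_inj.
  - exact: iota_uniq.
  move=> k; rewrite mem_iota subnKC; last by rewrite ltnW // ltnS rho_le.
  apply/mapP/andP => [[x _ ->]|[le0 le1]]; first by rewrite ltnS !rho_le.
  by have [x xA <-] := rho_onto k le0 le1; exists x; rewrite ?mem_enum.
by rewrite cardE -(size_map rho) (perm_size perm_rho) size_iota.
Qed.

(** * Permutations that are minimal at prescribed positions *)

Lemma ltn_ord_neq (n : nat) (i j : 'I_n) : i < j -> i != j.
Proof. by move=> ij; rewrite -val_eqE /= ltn_eqF. Qed.

(** The block starts are abstracted to an arbitrary predicate [B]; the link with [Cset] is made only
    at the end. *)
Definition minimal_at (n : nat) (B : pred 'I_n) (x : 'S_n) : Prop :=
  forall b k : 'I_n, B b -> b < k -> x b < x k.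

Lemma minimal_at1 (n : nat) (B : pred 'I_n) : minimal_at B 1%g.
Proof. by move=> b k _; rewrite !perm1. Qed.

(** A start before [i] sees the same set of later entries, the entry at [j] only decreases, and a
    start strictly between [i] and [j] has by minimality an entry below [x j], hence below [x i] by
    the gap condition. *)
Lemma minimal_at_swap (n : nat) (B : pred 'I_n) (x : 'S_n) (i j : 'I_n) :
  minimal_at B x -> ~~ B i -> i < j -> x i < x j ->
  (forall k : 'I_n, i < k -> k < j -> ~~ (x i < x k < x j)) ->
  minimal_at B (swap x i j).
Proof.
move=> Bx nBi ij xij gap b k Bb bk.
have bi : b != i by apply: contraNneq nBi => <-.
have [ebj|bj] := eqVneq b j.
  move: bk Bb; rewrite ebj swapR => jk Bj.
  rewrite swapD -?val_eqE /= ?gtn_eqF //; last exact: ltn_trans jk.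
  exact: ltn_trans (Bx j k Bj jk).
rewrite (swapD _ bi bj); have [eki|ki] := eqVneq k i.
  by rewrite eki swapL; apply: Bx => //; rewrite eki in bk; apply: ltn_trans ij.
have [ekj|kj] := eqVneq k j; last by rewrite swapD //; apply: Bx.
rewrite ekj swapR in bk *; have [lt_bi|le_ib] := ltnP b i; first exact: Bx.
have ib : i < b by rewrite ltn_neqAle eq_sym bi.
have := gap b ib bk; rewrite (Bx b j Bb bk) andbT -leqNgt leq_eqVlt.
by case/predU1P => // /perm_val_inj e; rewrite e eqxx in bi.
Qed.

Lemma minimal_at_first_diff (n : nat) (B : pred 'I_n) (x y : 'S_n) (i : 'I_n) :
  minimal_at B x -> minimal_at B y -> x i != y i ->
  (forall a : 'I_n, a < i -> x a = y a) -> ~~ B i.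
Proof.
move=> Bx By xyi agree; apply/negP => Bi.
have [j ij xj] := first_diff_later xyi agree.
have [||k ik yk] := @first_diff_later _ y x i; first by rewrite eq_sym.
  by move=> a /agree.
by have := Bx i j Bi ij; have := By i k Bi ik; rewrite xj yk; lia.
Qed.

(** Together with [minimal_at] this fixes the permutation from left to right: the least remaining
    entry on [B], the greatest off [B]. *)
Definition maximal_off (n : nat) (B : pred 'I_n) (x : 'S_n) : Prop :=
  forall i k : 'I_n, ~~ B i -> i < k -> x k < x i.

Lemma maximal_off_uniq (n : nat) (B : pred 'I_n) (x y : 'S_n) :
  minimal_at B x -> minimal_at B y -> maximal_off B x -> maximal_off B y -> x = y.
Proof.
move=> Bx By Mx My; apply/eqP; apply: contraT => /first_diff[i xyi agree].
have nBi := minimal_at_first_diff Bx By xyi agree.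
have [j ij xj] := first_diff_later xyi agree.
have [||k ik yk] := @first_diff_later _ y x i; first by rewrite eq_sym.
  by move=> a /agree.
by have := Mx i j nBi ij; have := My i k nBi ik; rewrite xj yk; lia.
Qed.

(** Swapping a non-start with the first larger later entry preserves [minimal_at] and raises [inv],
    so the process ends. By uniqueness [z] is the same for every [x], which gives the maximum. *)
Lemma exists_maximal_off (n : nat) (B : pred 'I_n) (x : 'S_n) : minimal_at B x ->
  exists z : 'S_n, [/\ minimal_at B z, maximal_off B z & bruhat_le x z].
Proof.
have [m] := ubnP (#|{: 'I_n * 'I_n}| - inv x); elim: m x => // m IHm x lt_m Bx.
have [/existsP[i /existsP[k0 Pk0]]|none] := boolP [exists i : 'I_n,
    exists k : 'I_n, [&& ~~ B i, i < k & x i < x k]]; last first.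
  exists x; split => //; last exact: bruhat_le_refl.
  move=> i k nBi ik; move/existsPn/(_ i)/existsPn/(_ k): none.
  rewrite nBi ik /= -leqNgt leq_eqVlt => /predU1P[|//].
  by move/perm_val_inj => e; rewrite e ltnn in ik.
case: (arg_minnP (P := fun k : 'I_n => [&& ~~ B i, i < k & x i < x k])
  (@nat_of_ord n) Pk0) => k /and3P[nBi ik xik] mink.
have gap (c : 'I_n) : i < c -> c < k -> ~~ (x i < x c < x k).
  by move=> ic ck; apply/negP => /andP[xic _]; have := mink c; rewrite nBi ic xic; lia.
have st : bruhat_step x (swap x i k) by apply/bruhat_stepP; exists i, k.
have [|z [Bz Mz le_z]] := IHm (swap x i k) _ (minimal_at_swap Bx nBi ik xik gap).
  have : inv (swap x i k) <= #|{: 'I_n * 'I_n}| by exact: max_card.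
  by rewrite (bruhat_step_inv st); move: lt_m; lia.
by exists z; split => //; apply: bruhat_le_trans (connect1 st) le_z.
Qed.

(** * The labeling *)

(** The positions are recovered from the two permutations, because a labeling is a function of poset
    elements; [(0, 0)] is a dummy value for pairs not related by a swap. *)
Definition cover_label (n : nat) (x y : 'S_n) : (nat *l nat)%type :=
  if [pick ij : 'I_n * 'I_n | (ij.1 < ij.2) && (y == swap x ij.1 ij.2)] is Some ij
  then (ij.1 : nat, ij.2 : nat) else (0, 0).

Lemma cover_label_swap (n : nat) (x : 'S_n) (i j : 'I_n) : i < j ->
  cover_label x (swap x i j) = (i : nat, j : nat).
Proof.
move=> ij; rewrite /cover_label; case: pickP => [[a b] /= /andP[ab /eqP e]|].
  have et : tperm i j = tperm a b by exact: mulIg e.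
  have := congr1 (fun s : 'S_n => s a) et; rewrite tpermL.
  case: tpermP => [-> ->|ea eib|_ _ eab] //; last by rewrite eab ltnn in ab.
  by rewrite -eib ea in ab; have := ltn_trans ij ab; rewrite ltnn.
by move/(_ (i, j)); rewrite /= ij eqxx.
Qed.

Lemma le_lexi_natE (a b c d : nat) :
  (((a, b) : (nat *l nat)%type) <= (c, d))%O = (a < c) || ((a == c) && (b <= d)).
Proof. by rewrite Order.ProdLexiOrder.lexi_pair !leEnat; lia. Qed.

Lemma lt_lexi_natE (a b c d : nat) :
  (((a, b) : (nat *l nat)%type) < (c, d))%O = (a < c) || ((a == c) && (b < d)).
Proof. by rewrite Order.ProdLexiOrder.ltxi_pair !leEnat ltEnat; lia. Qed.

(* A step can only enlarge the first entry it changes. *)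
Lemma swap_le_first (n : nat) (x y : 'S_n) (i a b : 'I_n) :
  (forall c : 'I_n, c < i -> x c = y c) -> a < b -> x a < x b ->
  bruhat_le (swap x a b) y -> i <= a.
Proof.
move=> agree ab xab /bruhat_le_dominated dy; rewrite leqNgt; apply/negP => ai.
have : swap x a b a <= y a.
  apply: dominated_first_diff dy _ => c ca.
  by rewrite swapD ?ltn_ord_neq //; [apply/agree/(ltn_trans ca) | apply: ltn_trans ab].
by rewrite swapL -agree // leqNgt xab.
Qed.

Lemma swap_le_at (n : nat) (x y : 'S_n) (i b : 'I_n) :
  (forall c : 'I_n, c < i -> x c = y c) -> i < b ->
  bruhat_le (swap x i b) y -> x b <= y i.
Proof.
move=> agree ib /bruhat_le_dominated dy; rewrite -{1}(swapL x i b).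
apply: dominated_first_diff dy _ => c ci.
by rewrite swapD ?ltn_ord_neq //; [apply: agree | apply: ltn_trans ib].
Qed.

(** The conclusion is [(i, j) <= (a, b)] lexicographically, unfolded. If [a = i] and [b < j], then
    [x b] would lie in [(x i, y i]], against the choice of [j]. *)
Lemma greedy_label_min (n : nat) (x y : 'S_n) (i j a b : 'I_n) :
  greedy x y i j -> a < b -> x a < x b -> bruhat_le (swap x a b) y ->
  (i < a) || (i == a :> nat) && (j <= b).
Proof.
case=> agree ij xij gap ab xab le_y.
have := swap_le_first agree ab xab le_y; rewrite leq_eqVlt => /predU1P[eia|->//].
move/val_inj: eia ab xab le_y => <- ib xib /(swap_le_at agree ib) xby.
rewrite ltnn eqxx /= leqNgt; apply/negP => bj.
by have := gap b ib bj; rewrite xib xby.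
Qed.

(** After the swap position [i] holds [x j]; a further step [(i, b)] with [b < j] would need
    [x j < x b <= y i], so [b] would have been chosen before [j]. *)
Lemma greedy_label_incr (n : nat) (x y : 'S_n) (i j a b : 'I_n)
    (z := swap x i j) :
  greedy x y i j -> a < b -> z a < z b -> bruhat_le (swap z a b) y ->
  (i < a) || (i == a :> nat) && (j <= b).
Proof.
case=> agree ij /andP[xij xjy] gap ab zab le_y.
have agree_z (c : 'I_n) : c < i -> z c = y c.
  by move=> ci; rewrite swapD ?ltn_ord_neq //; [apply: agree | apply: ltn_trans ij].
have := swap_le_first agree_z ab zab le_y; rewrite leq_eqVlt => /predU1P[eia|->//].
move/val_inj: eia ab zab le_y => <- ib zib /(swap_le_at agree_z ib) zby.
rewrite ltnn eqxx /= leqNgt; apply/negP => bj; move: zib zby.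
rewrite /z swapL swapD ?(ltn_ord_neq bj) // 1?eq_sym ?(ltn_ord_neq ib) // => xjb xby.
by have := gap b ib bj; rewrite xby (ltn_trans xij xjb).
Qed.

(** * The subposet: its covers, labels and chains *)

Definition Cposet_of (n : nat) (lambda : seq nat) (x : 'S_n)
    (Cx : x \in Cset n lambda) : Cposet n lambda :=
  exist (fun y : bruhat n => y \in Cset n lambda) x Cx.

Lemma Cposet_leE (n : nat) (lambda : seq nat) (u v : Cposet n lambda) :
  (u <= v)%O = bruhat_le (val u : 'S_n) (val v).
Proof. by []. Qed.

Lemma Cposet_lt_inv (n : nat) (lambda : seq nat) (u v : Cposet n lambda) :
  (u < v)%O -> inv (val u : 'S_n) < inv (val v : 'S_n).
Proof.
rewrite lt_neqAle => /andP[ne]; rewrite Cposet_leE => /bruhat_le_inv[] // e.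
by rewrite (val_inj e) eqxx in ne.
Qed.

Lemma Cposet_step_lt (n : nat) (lambda : seq nat) (u v : Cposet n lambda) :
  bruhat_step (val u : 'S_n) (val v) -> (u < v)%O.
Proof.
move=> st; rewrite lt_neqAle Cposet_leE [bruhat_le _ _](connect1 st) andbT.
by apply/eqP => e; have := bruhat_step_inv st; rewrite e; lia.
Qed.

Section Blocks.

Variables (n : nat) (lambda : seq nat) (B : pred 'I_n).
Hypothesis mem_C : forall x : 'S_n, x \in Cset n lambda <-> minimal_at B x.
Implicit Types u v w : Cposet n lambda.
Local Notation perm_of u := (val u : 'S_n).

Lemma Cposet_minimal_at u : minimal_at B (perm_of u).
Proof. by apply/mem_C; case: u. Qed.

(** The greedy step of the full Bruhat order stays in the subposet, because the first difference is
    not a block start. *)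
Lemma Cposet_greedy u v : (u < v)%O -> exists w i j,
  [/\ greedy (perm_of u) (perm_of v) i j, perm_of w = swap (perm_of u) i j & (w <= v)%O].
Proof.
rewrite lt_neqAle Cposet_leE => /andP[ne uv].
have dom := bruhat_le_dominated uv.
have [|i [j g]] := exists_greedy dom; first by rewrite (inj_eq val_inj).
have nBi : ~~ B i.
  case: (g) => agree _ /andP[lt_ij le_j] _; have lt_i := leq_trans lt_ij le_j.
  apply: minimal_at_first_diff (Cposet_minimal_at u) (Cposet_minimal_at v) _ agree.
  by rewrite -val_eqE /= ltn_eqF.
have Cw : swap (perm_of u) i j \in Cset n lambda.
  apply/mem_C; case: (g) => _ ij /andP[xij _] _.
  exact: minimal_at_swap (Cposet_minimal_at u) nBi ij xij (greedy_gap g).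
exists (Cposet_of Cw), i, j; split=> //.
by rewrite Cposet_leE; apply: greedy_le g uv.
Qed.

(** A cover [v] of [u] must equal the result of the greedy step from [u], which lies strictly above
    [u] and weakly below [v]; conversely a step raises [inv] by one and leaves no room between. *)
Lemma Cposet_coversP u v : covers u v <-> bruhat_step (perm_of u) (perm_of v).
Proof.
split=> [uv|st].
  have [w [i [j [g ew wv]]]] := Cposet_greedy (covers_lt uv).
  have st := greedy_step g; rewrite -ew in st.
  have [<-//|ne_wv] := eqVneq w v.
  case: (covers_nobetween uv (Cposet_step_lt st)).
  by rewrite lt_neqAle ne_wv.
apply: coversI (Cposet_step_lt st) _ => w /Cposet_lt_inv uw /Cposet_lt_inv wv.
by have := bruhat_step_inv st; lia.
Qed.

Definition Cposet_label u v := cover_label (perm_of u) (perm_of v).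

Lemma Cposet_coversE u v : covers u v -> exists i j : 'I_n,
  [/\ i < j, perm_of u i < perm_of u j, perm_of v = swap (perm_of u) i j,
      Cposet_label u v = (i : nat, j : nat) &
      forall k : 'I_n, i < k -> k < j -> ~~ (perm_of u i < perm_of u k < perm_of u j)].
Proof.
move/Cposet_coversP/bruhat_stepP => [i [j [ij uij ev gap]]]; exists i, j.
by split => //; rewrite /Cposet_label ev cover_label_swap.
Qed.

(** Increasing labels keep their first position at or beyond [a], so no step of the chain touches
    [i]. *)
Lemma last_fixed_before s u (i : 'I_n) (a b : nat) :
  path (@covers _ (Cposet n lambda)) u s ->
  path <=%O ((a, b) : (nat *l nat)%type) (labels Cposet_label u s) -> i < a ->
  perm_of (last u s) i = perm_of u i.
Proof.
elim: s u a b => //= w s IHs u a b /andP[/Cposet_coversE[c [d [cd _ ew el _]]] ws].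
rewrite el le_lexi_natE => /andP[le_ac sorted_s] ia.
have ic : i < c by move: le_ac ia; lia.
by rewrite (IHs _ _ _ ws sorted_s ic) ew swapD // ltn_ord_neq // (ltn_trans ic).
Qed.

(* As long as the labels (i, b) have b > j, the gap condition keeps the entry
   in position i below the untouched entry in position j. *)
Lemma last_below s u (i j : 'I_n) (a b : nat) :
  path (@covers _ (Cposet n lambda)) u s ->
  path <=%O ((a, b) : (nat *l nat)%type) (labels Cposet_label u s) ->
  (((i : nat, j : nat) : (nat *l nat)%type) < (a, b))%O -> i < j ->
  perm_of u i < perm_of u j -> perm_of (last u s) i < perm_of u j.
Proof.
elim: s u a b => //= w s IHs u a b /andP[/Cposet_coversE[c [d [cd ucd ew el gap]]] ws].
rewrite el => /andP[le_ab sorted_s] /lt_le_trans/(_ le_ab).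
rewrite lt_lexi_natE => lt_cd ij uij.
have [ic|le_ci] := ltnP i c.
  rewrite (last_fixed_before ws sorted_s ic) ew swapD // ltn_ord_neq //.
  exact: ltn_trans cd.
have eic : i = c by apply: val_inj => /=; move: lt_cd le_ci; lia.
rewrite -eic in cd ucd ew sorted_s gap lt_cd.
have jd : j < d by move: lt_cd; lia.
have wj : perm_of w j = perm_of u j.
  by rewrite ew swapD ?(ltn_ord_neq jd) // eq_sym ltn_ord_neq.
rewrite -wj; apply: (IHs _ _ _ ws sorted_s _ ij); first by rewrite lt_lexi_natE eqxx jd orbT.
rewrite wj ew swapL; have := gap j ij jd; rewrite uij /= -leqNgt leq_eqVlt.
by case/predU1P => // /perm_val_inj e; rewrite e ltnn in jd.
Qed.

Lemma Cposet_EL_labeling : EL_labeling Cposet_label.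
Proof.
apply: EL_labeling_of_first_step => x y xy.
have [z [i [j [g ez zy]]]] := Cposet_greedy xy; exists z.
have ij : i < j by case: g.
have xz : covers x z by apply/Cposet_coversP; rewrite ez; apply: greedy_step g.
have lz : Cposet_label x z = (i : nat, j : nat).
  by rewrite /Cposet_label ez cover_label_swap.
have zmin w : covers x w -> (w <= y)%O ->
    (Cposet_label x z <= Cposet_label x w)%O /\
    ((Cposet_label x w <= Cposet_label x z)%O -> w = z).
  move=> /Cposet_coversE[c [d [cd xcd ew -> _]]]; rewrite Cposet_leE ew lz.
  move=> /(greedy_label_min g cd xcd) le_cd; rewrite !le_lexi_natE; split => // le_ij.
  apply: val_inj; rewrite ew ez.
  by congr (swap _ _ _); apply: val_inj => /=; move: le_cd le_ij; lia.
split; [exact: conj xz zy | exact: zmin | | ].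
  move=> w /Cposet_coversE[c [d [cd zcd ew -> _]]].
  rewrite Cposet_leE ew lz le_lexi_natE ez; rewrite ez in zcd.
  exact: greedy_label_incr g cd zcd.
move=> w s; rewrite /increasing_chain /saturated_chain /=.
case/andP => /andP[/andP[xw ws] /eqP sy] sorted_s.
have wy : (w <= y)%O by rewrite -sy; apply: path_covers_le.
have [le_zw wz] := zmin w xw wy; apply/eqP; apply: contraT => ne_wz.
have lt_zw : (Cposet_label x z < Cposet_label x w)%O.
  by rewrite lt_leAnge le_zw; apply: contra ne_wz => /wz->.
have xij : perm_of x i < perm_of x j by case: g => _ _ /andP[].
(* A first label above [(i, j)] would leave the entry at [i] below [x j], although the chain ends at
   [y] and [x j <= y i]. That first label serves as its own lower bound [(a, b)]. *)
have : perm_of (last x (w :: s)) i < perm_of x j.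
  rewrite lz in lt_zw; case el: (Cposet_label x w) lt_zw => [a b] lt_ab.
  apply: (last_below (a := a) (b := b)) lt_ab ij xij; first by rewrite /= xw.
  by rewrite /= el lexx /= -el.
by rewrite /= sy ltnNge; case: g => _ _ /andP[_ ->].
Qed.

(** The identity is the minimum, the unique [maximal_off] element the maximum, and [inv] the rank
    function, since greedy steps raise it by one. *)
Lemma Cposet_EL_shellable : EL_shellable (Cposet n lambda).
Proof.
have C1 : (1%g : 'S_n) \in Cset n lambda by apply/mem_C/minimal_at1.
have [z [Bz Mz _]] := exists_maximal_off (@minimal_at1 n B).
have Cz : z \in Cset n lambda by apply/mem_C.
pose u0 := Cposet_of C1; pose u1 := Cposet_of Cz.
have min0 u : (u0 <= u)%O by exact: bruhat_le1x.
have max1 u : (u <= u1)%O.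
  have [z' [Bz' Mz' le_z']] := exists_maximal_off (Cposet_minimal_at u).
  by rewrite Cposet_leE /= (maximal_off_uniq Bz Bz' Mz Mz').
split; [by exists u0 | by exists u1 | | ].
  apply: (graded_of_rank (rho := fun u => inv (perm_of u)) min0 max1).
    exact: Cposet_lt_inv.
  move=> u v /Cposet_greedy[w [i [j [g ew wv]]]]; exists w.
  have st : bruhat_step (perm_of u) (perm_of w) by rewrite ew; apply: greedy_step g.
  split => //; last exact: bruhat_step_inv.
  by apply: covers_lt; apply/Cposet_coversP.
by exists _, _, Cposet_label; exact: Cposet_EL_labeling.
Qed.

End Blocks.

(** * The elements of [Cset n lambda] *)

Lemma flatten_uniq_block (T : eqType) (ss : seq (seq T)) (c : seq T) :
  uniq (flatten ss) -> c \in ss -> uniq c.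
Proof.
elim: ss => //= d ss IHss; rewrite cat_uniq inE => /and3P[ud _ uss].
by case/predU1P => [->|/(IHss uss)].
Qed.

Lemma flatten_uniq_disjoint (T : eqType) (ss : seq (seq T)) (c d : seq T) (v : T) :
  uniq (flatten ss) -> c \in ss -> d \in ss -> v \in c -> v \in d -> c = d.
Proof.
elim: ss => //= e ss IHss; rewrite cat_uniq !inE => /and3P[_ /hasPn dis uss].
have sub f : f \in ss -> v \in f -> v \notin e.
  by move=> fss vf; apply: dis; apply/flattenP; exists f.
case/predU1P => [->|css]; case/predU1P => [->|dss] vc vd //; last exact: IHss.
  by rewrite (negPf (sub d dss vd)) in vc.
by rewrite (negPf (sub c css vc)) in vd.
Qed.

Lemma flatten_uniq_heads (T : eqType) (x0 : T) (ss : seq (seq T)) :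
  uniq (flatten ss) -> [::] \notin ss -> uniq (map (head x0) ss).
Proof.
elim: ss => //= c ss IHss; rewrite cat_uniq inE => /and3P[_ /hasPn dis uss].
case: c dis => [//|a c] dis; rewrite /= => nil_ss; rewrite IHss // andbT.
apply/negP => /mapP[[|b d] dss /= eab]; first by rewrite dss in nil_ss.
have /dis : a \in flatten ss by apply/flattenP; exists (b :: d); rewrite // eab mem_head.
by rewrite mem_head.
Qed.

(** Each value goes to its cyclic successor in the only block containing it. Equal images force
    equal blocks, where [prev] inverts [next]. *)
Lemma perm_of_cycles (T : finType) (ss : seq (seq T)) :
  uniq (flatten ss) -> (forall v, v \in flatten ss) ->
  exists p : {perm T}, forall c v, c \in ss -> v \in c -> p v = next c v.
Proof.
move=> uss all_ss.
pose f v := next (nth [::] ss (find (fun c : seq T => v \in c) ss)) v.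
have fE c v : c \in ss -> v \in c -> f v = next c v.
  move=> css vc; have has_v : has (fun c : seq T => v \in c) ss by apply/hasP; exists c.
  congr next; apply: flatten_uniq_disjoint uss _ css _ vc.
    by rewrite mem_nth // -has_find.
  exact: (nth_find [::] has_v).
have f_inj : injective f.
  move=> v w; have /flattenP[c css vc] := all_ss v; have /flattenP[d dss wd] := all_ss w.
  rewrite (fE c) // (fE d) // => e; have ecd : c = d.
    by apply: (flatten_uniq_disjoint uss css dss (v := next c v)); rewrite ?mem_next // e mem_next.
  by rewrite -ecd in e; apply: (can_inj (prev_next (flatten_uniq_block uss css))).
by exists (perm f_inj) => c v css vc; rewrite permE; apply: fE.
Qed.

Lemma traject_cycle (T : finType) (p : {perm T}) (a : T) (c : seq T) :
  uniq (a :: c) -> (forall v, v \in a :: c -> p v = next (a :: c) v) ->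
  traject p a (size c).+1 = a :: c.
Proof.
move=> uc pE; have : fcycle p (a :: c).
  by apply: cycle_from_next => // v vc; rewrite /= pE.
rewrite /= rcons_path => /andP[/fpathP[m ->] _]; congr cons.
by rewrite size_traject.
Qed.

Lemma porbit_cycle (T : finType) (p : {perm T}) (a : T) (c : seq T) :
  uniq (a :: c) -> (forall v, v \in a :: c -> p v = next (a :: c) v) ->
  porbit p a = [set v in a :: c].
Proof.
move=> uc pE; apply/setP => v; rewrite inE; apply/porbitP/idP => [[i ->]|].
  rewrite permX; elim: i => [|i IHi]; first exact: mem_head.
  by rewrite iterS pE // mem_next.
rewrite -{1}(traject_cycle uc pE) => /trajectP[i _ ->].
by exists i; rewrite permX.
Qed.

(** * Blocks of the one-line notation *)

Lemma nth_one_line (n : nat) (x : 'S_n) (v k : 'I_n) : nth v (one_line x) k = x k.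
Proof. by rewrite (nth_map v) ?size_enum_ord // nth_ord_enum. Qed.

Lemma one_line_inj (n : nat) : injective (@one_line n).
Proof.
by move=> x y e; apply/permP => k; rewrite -(nth_one_line x k) e nth_one_line.
Qed.

Lemma size_one_line (n : nat) (x : 'S_n) : size (one_line x) = n.
Proof. by rewrite size_map size_enum_ord. Qed.

(* The default v is only reached when the block r is empty. *)
Definition block_minimal (n : nat) (ss : seq (seq 'I_n)) : Prop :=
  forall r r' (v : 'I_n), r <= r' -> v \in nth [::] ss r' ->
  nth v (nth [::] ss r) 0 <= v.

Definition block_start (n : nat) (lambda : seq nat) : pred 'I_n :=
  fun b => reshape_offset lambda b == 0.

Lemma minimal_at_blocks (n : nat) (lambda : seq nat) (x : 'S_n) (ss : seq (seq 'I_n)) :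
  0 \notin lambda -> shape ss = lambda -> flatten ss = one_line x ->
  block_minimal ss <-> minimal_at (block_start lambda) x.
Proof.
move=> lambda_gt0 sh fl; have sumn_lambda : sumn lambda = n.
  by rewrite -sh -size_flatten fl size_one_line.
have xE (k : 'I_n) v :
    x k = nth v (nth [::] ss (reshape_index lambda k)) (reshape_offset lambda k).
  by rewrite -(nth_one_line x v k) -fl nth_flatten sh.
split=> [min_ss b k /eqP Bb bk|Bx r r' v le_r vr'].
  have k_lt : k < sumn lambda by rewrite sumn_lambda.
  rewrite ltn_neqAle; apply/andP; split.
    by apply/eqP => /perm_val_inj e; rewrite e ltnn in bk.
  rewrite (xE b (x k)) Bb; apply: min_ss (reshape_index lambda b) (reshape_index lambda k) _ _ _.
    by have := ltnW bk; rewrite (reshape_leq lambda); lia.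
  rewrite (xE k k); apply: mem_nth; rewrite -nth_shape sh.
  exact: reshape_offsetP.
have sz_r' : index v (nth [::] ss r') < nth 0 lambda r'.
  by rewrite -sh nth_shape index_mem.
have r'_lt : r' < size lambda.
  by rewrite ltnNge; apply/negP => le; rewrite [nth 0 _ _]nth_default in sz_r'.
(* Block [r] is nonempty because [lambda] has no zero part, so its head is a genuine entry and not
   the default [v]. *)
have sz_r : 0 < nth 0 lambda r.
  rewrite lt0n; apply: contraNneq lambda_gt0 => <-; apply: mem_nth.
  exact: leq_ltn_trans r'_lt.
have b_lt := flatten_indexP sz_r; have k_lt := flatten_indexP sz_r'.
rewrite sumn_lambda in b_lt k_lt.
pose b := Ordinal b_lt; pose k := Ordinal k_lt.
have xb : x b = nth v (nth [::] ss r) 0.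
  by rewrite (xE b v) /= flatten_indexKl // flatten_indexKr.
have xk : x k = v.
  by rewrite (xE k v) /= flatten_indexKl // flatten_indexKr // nth_index.
have le_bk : b <= k.
  rewrite (reshape_leq lambda) /= !flatten_indexKl // !flatten_indexKr //.
  by move: le_r; rewrite leq_eqVlt; lia.
rewrite -xb -xk; move: le_bk; rewrite leq_eqVlt => /predU1P[/val_inj-> //|bk].
by apply/ltnW/Bx => //; rewrite /block_start /= flatten_indexKr.
Qed.

Lemma sorted_enum_ord (n : nat) : sorted (fun i j : 'I_n => i <= j) (enum 'I_n).
Proof.
by have := iota_sorted 0 n; rewrite -val_enum_ord sorted_map.
Qed.

(** Each cycle starts at the least element of its orbit, and these minima are listed in increasing
    order. *)
Lemma std_cyclic_form_block_minimal (n : nat) (p : 'S_n) :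
  block_minimal (std_cyclic_form p).
Proof.
move=> r r' v le_r; set ms := [seq i <- enum 'I_n | cycle_min p i].
have [r'_lt|le_r'] := ltnP r' (size ms); last first.
  by rewrite [nth _ _ r']nth_default ?size_map.
have r_lt := leq_ltn_trans le_r r'_lt.
rewrite /std_cyclic_form -/ms !(nth_map v) // -porbit_traject.
have -> m : nth v (traject p m #|porbit p m|) 0 = m.
  by rewrite (set_nth_default m) ?nth_traject ?size_traject // (cardD1 m) porbit_id.
have /(all_nthP v)/(_ r' r'_lt) /forall_inP min_r' := filter_all (cycle_min p) (enum 'I_n).
move=> /min_r'; apply: leq_trans; apply: (@sorted_leq_nth _ (fun i j : 'I_n => i <= j)).
- by move=> ? ? ?; apply: leq_trans.
- by move=> ?; apply: leqnn.
- by apply: sorted_filter (sorted_enum_ord n) => ? ? ?; apply: leq_trans.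
- by rewrite inE.
- by rewrite inE.
- exact: le_r.
Qed.

(** The blocks themselves are taken as cycles. Their heads are the orbit minima and increase from
    block to block, so the standard form lists the blocks in the given order. *)
Lemma exists_std_cyclic_form (n : nat) (ss : seq (seq 'I_n)) :
  uniq (flatten ss) -> (forall v, v \in flatten ss) -> [::] \notin ss ->
  block_minimal ss -> exists p : 'S_n, std_cyclic_form p = ss.
Proof.
move=> uss all_ss nil_ss min_ss; have [p pE] := perm_of_cycles uss all_ss; exists p.
have min_head a c v : a :: c \in ss -> v \in a :: c -> a <= v.
  move=> css vc; have := min_ss _ (index (a :: c) ss) v (leqnn _).
  by rewrite nth_index //; apply.
have orbE a c : a :: c \in ss -> porbit p a = [set v in a :: c].
  move=> css; apply: porbit_cycle (flatten_uniq_block uss css) _.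
  by move=> v; apply: pE.
(* [head] needs a default element; for [n = 0] there is none, and both sides are empty. *)
case: (pickP 'I_n) => [i0 _|none]; last first.
  have -> : ss = [::].
    by case: ss nil_ss {uss all_ss min_ss pE min_head orbE} => // -[//|a c]; have := none a.
  by rewrite /std_cyclic_form; case: (enum 'I_n) => // a; have := none a.
have filterE : [seq i <- enum 'I_n | cycle_min p i] = map (head i0) ss.
  apply: (@sorted_eq _ (fun i j : 'I_n => i <= j)).
  - by move=> ? ? ?; apply: leq_trans.
  - by move=> i j; rewrite -eqn_leq => /eqP/val_inj.
  - by apply: sorted_filter (sorted_enum_ord n) => ? ? ?; apply: leq_trans.
  - apply/(sortedP i0) => r; rewrite size_map => r_lt.
    rewrite !(nth_map [::]) ?(ltnW r_lt) //.
    have := mem_nth [::] r_lt; have := mem_nth [::] (ltnW r_lt).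
    have := min_ss r r.+1 _ (leqnSn r).
    case: (nth _ ss r) => [|a c]; first by rewrite (negPf nil_ss).
    case: (nth _ ss r.+1) => [|b d]; first by rewrite (negPf nil_ss).
    by move=> /(_ b (mem_head b d)).
  apply: uniq_perm; first by rewrite filter_uniq // enum_uniq.
    exact: flatten_uniq_heads.
  move=> i; rewrite mem_filter mem_enum andbT; apply/forall_inP/mapP.
    move=> min_i; have /flattenP[[|a c] css ic] := all_ss i; first by [].
    exists (a :: c) => //=; apply/val_inj/eqP; rewrite /= eqn_leq (min_head a c) // andbT.
    have iorb : i \in porbit p a by rewrite (orbE a c) // inE.
    by apply: min_i; rewrite porbit_sym.
  case=> -[|a c] css /= ->; first by rewrite css in nil_ss.
  by move=> j; rewrite (orbE a c) // inE => /(min_head a c)->.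
rewrite /std_cyclic_form filterE -map_comp; apply: map_id_in => -[|a c] css /=.
  by rewrite css in nil_ss.
have uc := flatten_uniq_block uss css.
rewrite (orbE a c) // cardsE (card_uniqP uc).
by apply: traject_cycle uc _ => v; apply: pE.
Qed.

(** In one direction the blocks are the cycles of a preimage under [Omega]; in the other, the
    one-line notation is cut into blocks of sizes [lambda], which become the cycles of a
    preimage. *)
Lemma mem_Cset (n : nat) (lambda : seq nat) (x : 'S_n) : is_composition n lambda ->
  x \in Cset n lambda <-> minimal_at (block_start lambda) x.
Proof.
case=> lambda_gt0 sumn_lambda; split.
  case/imsetP => p; rewrite inE => /eqP type_p ->.
  apply/(minimal_at_blocks lambda_gt0 type_p (esym (one_line_Omega p))).
  exact: std_cyclic_form_block_minimal.
have sz : size (one_line x) = sumn lambda by rewrite size_one_line.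
have sh : shape (reshape lambda (one_line x)) = lambda by rewrite reshapeKl // sz.
have fl : flatten (reshape lambda (one_line x)) = one_line x by rewrite reshapeKr // sz.
move=> /(minimal_at_blocks lambda_gt0 sh fl) min_ss.
have [||||p pE] := @exists_std_cyclic_form n (reshape lambda (one_line x)).
- by rewrite fl map_inj_uniq ?enum_uniq //; apply: perm_inj.
- by move=> v; rewrite fl -[v](permKV x) map_f // mem_enum.
- by apply: contra lambda_gt0 => /(map_f size); rewrite -/shape sh.
- exact: min_ss.
apply/imsetP; exists p; first by rewrite inE /composition_type pE -/shape sh.
by apply: one_line_inj; rewrite one_line_Omega /cyclic_word pE fl.
Qed.

Theorem theoremC (n : nat) (lambda : seq nat) (hlambda : is_composition n lambda) :
  EL_shellable (Cposet n lambda).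
Proof. exact: Cposet_EL_shellable (fun x => mem_Cset x hlambda). Qed.
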